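(* Fix a price vector $\boldsymbol\phi=(\phi_1,\phi_2)\in[0,\phi_h]^2$. With the Wardrop splits $\lambda_i(\boldsymbol\phi;\beta,\alpha)$ and payoffs $\mathcal M_i(\boldsymbol\phi;\beta,\alpha)$ under the pick-up-delay metric $\mathcal D_i$, extended to $\beta=0$ as specified in the context, the mappings $(\beta,\alpha)\mapsto\lambda_i(\boldsymbol\phi;\beta,\alpha)$ and $(\beta,\alpha)\mapsto\mathcal M_i(\boldsymbol\phi;\beta,\alpha)$ are continuous over $[0,\infty)\times[0,1)$ for each $i\in\{1,2\}$.
   Context: Fix $\phi_h>0$ and $f:[0,\phi_h]\to\mathbb R$ strictly concave, strictly decreasing and differentiable, with $0<f(\phi)\le1$ for all $\phi$ and $f(0)=1$. Fix $\Lambda>0$, $e>0$, $\rho:=e/\Lambda$, and a positive integer $\bar N$. The extended inverse $f^{-1}:[0,\infty)\to[0,\phi_h]$: $f^{-1}(x)=\phi_h$ for $0\le x<f(\phi_h)$; the unique $\phi$ with $f(\phi)=x$ for $f(\phi_h)\le x\le1$; $0$ for $x>1$. Case $\beta>0$, $\alpha\in[0,1)$. For $\lambda\in[0,\Lambda]$ let $\mu_{i,n}=\prod_{a=1}^n\frac{e}{\lambda f(\phi_i)+a\beta}$ (so $\mu_{i,0}=1$), $\mathcal U_i(\lambda)=\big(\sum_{n\ge0}\mu_{i,n}\big)^{-1}$, $\mathcal B_i(\lambda)=1-f(\phi_i)+f(\phi_i)\,\mathcal U_i(\lambda)$, and $$\mathcal D_i(\boldsymbol\phi;\lambda,\beta,\alpha)=\mathcal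 B_i(\lambda)+\alpha f(\phi_i)\frac{\sum_{n=1}^{\bar N}\mu_{i,n}/n}{\sum_{n=0}^\infty\mu_{i,n}}.$$ The Wardrop split is: $\lambda_1(\boldsymbol\phi;\beta,\alpha)$ is the (unique) minimizer over $\lambda\in[0,\Lambda]$ of $(\mathcal D_1(\boldsymbol\phi;\lambda,\beta,\alpha)-\mathcal D_2(\boldsymbol\phi;\Lambda-\lambda,\beta,\alpha))^2$, and $\lambda_2=\Lambda-\lambda_1$. Payoffs: $\mathcal M_i(\boldsymbol\phi;\beta,\alpha)=\lambda_i f(\phi_i)\phi_i(1-\mathcal U_i(\lambda_i))$ with $\lambda_i=\lambda_i(\boldsymbol\phi;\beta,\alpha)$. (For $\alpha=0$, $\mathcal D_i=\mathcal B_i$.) Case $\beta=0$, $\alpha=0$. With $m(\phi):=(\Lambda f(\phi)-e)\phi$, if $\phi_1>\phi_2$: - if $\phi_1\in[0,f^{-1}(2\rho))$: $\lambda_1=\Lambda/2$, $\mathcal M_1=e\phi_1$, $\mathcal M_2=e\phi_2$; - if $\phi_1\in[f^{-1}(2\rho),f^{-1}(\rho))$: $\lambda_1=\Lambda-e/f(\phi_1)$, $\mathcal M_1=m(\phi_1)$, $\mathcal M_2=e\phi_2$; - if $\phi_1\in[f^{-1}(\rho),\phi_h]$: $\lambda_1=0$, $\mathcal M_1=0$, $\mathcal M_2=\Lambda f(\phi_2)\phi_2$. If $\phi_1=\phi_2$: $\lambda_1=\Lambda/2$, and for $i=1,2$, $\mathcal M_i=e\phi_i$ if $\phi_1\in[0,f^{-1}(2\rho))$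 and $\mathcal M_i=\frac\Lambda2 f(\phi_i)\phi_i$ if $\phi_1\in[f^{-1}(2\rho),\phi_h]$. Always $\lambda_2=\Lambda-\lambda_1$; if $\phi_1<\phi_2$ interchange the roles of the platforms. Case $\beta=0$, $\alpha\in(0,1)$. For $\lambda\in[0,\Lambda]$ define $$\mathcal D_i(\boldsymbol\phi;\lambda,0,\alpha)=1-f(\phi_i)+\mathbf 1_{\left\{\frac{e}{\lambda f(\phi_i)}<1\right\}}\,f(\phi_i)\Big(1-\frac{e}{\lambda f(\phi_i)}\Big)\Big(1+\alpha\sum_{n=1}^{\bar N}\frac1n\Big(\frac{e}{\lambda f(\phi_i)}\Big)^n\Big)$$ (the second term being $0$ when $\lambda=0$). Let $\tilde\lambda^*(\alpha)$ be the unique minimizer over $\lambda_1\in[0,\Lambda]$ of $(\mathcal D_1(\boldsymbol\phi;\lambda_1,0,\alpha)-\mathcal D_2(\boldsymbol\phi;\Lambda-\lambda_1,0,\alpha))^2$, and let $$\bar\alpha=\frac{\frac e\Lambda-f(\phi_1)}{\big(f(\phi_2)-\frac e\Lambda\big)\sum_{n=1}^{\bar N}\frac1n\big(\frac{e}{\Lambda f(\phi_2)}\big)^n}.$$ If $\phi_1>\phi_2$: - if $\phi_1\in[0,f^{-1}(\rho))$: $\lambda_1(\boldsymbol\phi;0,\alpha)=\tilde\lambda^*(\alpha)$; - if $\phi_1\in[f^{-1}(\rho),\phi_h]$: $\lambda_1(\boldsymbol\phi;0,\alpha)=\tilde\lambda^*(\alpha)\,\mathbf 1_{\{\alpha>\bar\alpha\}}$.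 If $\phi_1=\phi_2$: $\lambda_1(\boldsymbol\phi;0,\alpha)=\Lambda/2$. Always $\lambda_2=\Lambda-\lambda_1$; if $\phi_1<\phi_2$ interchange the roles of the platforms. Payoffs: $\mathcal M_i(\boldsymbol\phi;0,\alpha)=e\phi_i\mathbf 1_{\{e<f(\phi_i)\lambda_i\}}+\lambda_i f(\phi_i)\phi_i\mathbf 1_{\{e\ge f(\phi_i)\lambda_i\}}$ with $\lambda_i=\lambda_i(\boldsymbol\phi;0,\alpha)$.
   Formalization: At β=α=0 with φ1>φ2 and φ1≥f⁻¹(ρ), M2 is eφ2 when Λf(φ2)>e; φ_h counts as lying in [0,f⁻¹(x)) when x<f(φ_h); at β=0<α with Λf(φ2)≤e, where no unique minimizer exists, λ1 is set to 0; likewise with roles interchanged. *)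

(* Defs.v *)
(* MathComp world, with MathComp-Analysis. *)
From HB Require Import structures.
From mathcomp Require Import all_boot all_order all_algebra.
From mathcomp Require Import all_classical all_reals all_analysis.

Set Implicit Arguments.
Unset Strict Implicit.
Unset Printing Implicit Defensive.

Import Order.TTheory GRing.Theory Num.Theory.
Import numFieldNormedType.Exports.

Local Open Scope classical_set_scope.
Local Open Scope ring_scope.

Definition strictly_concave_on {R : realType} (a b : R) (f : R -> R) : Prop :=
  forall x y t : R, a <= x <= b -> a <= y <= b -> x != y -> 0 < t < 1 ->
    t * f x + (1 - t) * f y < f (t * x + (1 - t) * y).

Definition strictly_decreasing_on {R : realType} (a b : R) (f : R -> R) : Prop :=
  forall x y : R, a <= x -> x < y -> y <= b -> f y < f x.

(* The increments stay in [a, b], so the derivative is one-sided at a and b and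
   the values of f outside [a, b] are irrelevant. *)
Definition differentiable_on {R : realType} (a b : R) (f : R -> R) : Prop :=
  forall x : R, a <= x <= b ->
    cvg ((f y - f x) / (y - x) @[y --> within [set z : R | a <= z <= b] x^']).

Definition argmin {R : realType} (Lambda : R) (g : R -> R) : set R :=
  [set l | 0 <= l <= Lambda /\ forall l', 0 <= l' <= Lambda -> g l <= g l'].

(* "The unique minimizer" of g over [0, Lambda], as a definite description.
   In the uses below, uniqueness fails only for beta = 0 when Lambda * f phi_j <= e
   for the cheaper platform j (both delays are then constant in l); the default
   value 0 is then the arrival rate of the more expensive platform. *)
Definition unique_argmin {R : realType} (Lambda : R) (g : R -> R) : R :=
  xget 0 [set l | argmin Lambda g = [set l]].

(* The extended inverse of f. *)
Definition finv {R : realType} (phih : R) (f : R -> R) (x : R) : R :=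
  if x < f phih then phih
  else if x <= 1 then xget 0 [set phi | 0 <= phi <= phih /\ f phi = x]
  else 0.

(* The price range written [0, f^-1(x)), i.e. the prices phi with x < f phi.
   When x < f phih the extended inverse is truncated at phih, although every
   price of [0, phih] satisfies x < f phi; the endpoint phih then belongs to
   the range.  The complementary range [f^-1(x), phih] is the negation. *)
Definition below_finv {R : realType} (phih : R) (f : R -> R) (x phi : R) : bool :=
  (phi < finv phih f x) || (x < f phih).

Section Platforms.
Context {R : realType}.
Variables (phih : R) (f : R -> R) (Lambda e : R) (Nbar : nat).

Let rho : R := e / Lambda.

Definition mu (phi beta l : R) (n : nat) : R :=
  \prod_(1 <= a < n.+1) (e / (l * f phi + a%:R * beta)).

Definition U (phi beta l : R) : R := (limn (series (mu phi beta l)))^-1.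

Definition B (phi beta l : R) : R := 1 - f phi + f phi * U phi beta l.

Definition D_pos (phi beta alpha l : R) : R :=
  B phi beta l
  + alpha * f phi * ((\sum_(1 <= n < Nbar.+1) mu phi beta l n / n%:R)
                     / limn (series (mu phi beta l))).

(* The guard 0 < l is needed because e / 0 = 0. *)
Definition D_zero (phi alpha l : R) : R :=
  1 - f phi +
  (if (0 < l) && (e / (l * f phi) < 1) then
     f phi * (1 - e / (l * f phi))
     * (1 + alpha * \sum_(1 <= n < Nbar.+1) n%:R^-1 * (e / (l * f phi)) ^+ n)
   else 0).

Definition D (phi beta alpha l : R) : R :=
  if beta == 0 then D_zero phi alpha l else D_pos phi beta alpha l.

Definition delay_gap2 (phi1 phi2 beta alpha l : R) : R :=
  (D phi1 beta alpha l - D phi2 beta alpha (Lambda - l)) ^+ 2.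

Definition lambda_star (phi1 phi2 beta alpha : R) : R :=
  unique_argmin Lambda (delay_gap2 phi1 phi2 beta alpha).

Definition alpha_bar (phi1 phi2 : R) : R :=
  (e / Lambda - f phi1) /
  ((f phi2 - e / Lambda)
   * \sum_(1 <= n < Nbar.+1) n%:R^-1 * (e / (Lambda * f phi2)) ^+ n).

(* For beta = 0: the rate of the platform charging phi1, assuming phi2 < phi1. *)
Definition lambda_high (phi1 phi2 alpha : R) : R :=
  if alpha == 0 then
    if below_finv phih f (2 * rho) phi1 then Lambda / 2
    else if below_finv phih f rho phi1 then Lambda - e / f phi1
    else 0
  else
    if below_finv phih f rho phi1 then lambda_star phi1 phi2 0 alpha
    else if alpha_bar phi1 phi2 < alpha then lambda_star phi1 phi2 0 alpha
    else 0.

Definition lambda1 (phi1 phi2 beta alpha : R) : R :=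
  if beta == 0 then
    if phi2 < phi1 then lambda_high phi1 phi2 alpha
    else if phi1 < phi2 then Lambda - lambda_high phi2 phi1 alpha
    else Lambda / 2
  else lambda_star phi1 phi2 beta alpha.

Definition lambda2 (phi1 phi2 beta alpha : R) : R :=
  Lambda - lambda1 phi1 phi2 beta alpha.

(* For beta = alpha = 0: payoffs of the platform with the strictly higher price
   phi, of the one with the strictly lower price phi' against phi, and of either
   one when both charge phi. *)
Definition M00_high (phi : R) : R :=
  if below_finv phih f (2 * rho) phi then e * phi
  else if below_finv phih f rho phi then (Lambda * f phi - e) * phi
  else 0.

(* In the last regime the cheaper platform receives the whole flow Lambda and
   serves min (e, Lambda * f phi') of it. *)
Definition M00_low (phi phi' : R) : R :=
  if below_finv phih f (2 * rho) phi then e * phi'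
  else if below_finv phih f rho phi then e * phi'
  else if e < Lambda * f phi' then e * phi'
  else Lambda * f phi' * phi'.

Definition M00_tie (phi : R) : R :=
  if below_finv phih f (2 * rho) phi then e * phi
  else Lambda / 2 * f phi * phi.

(* Payoff of a platform with price phi and rate l against the rival price psi. *)
Definition payoff (phi psi l beta alpha : R) : R :=
  if beta == 0 then
    if alpha == 0 then
      if psi < phi then M00_high phi
      else if phi < psi then M00_low psi phi
      else M00_tie phi
    else if e < f phi * l then e * phi else l * f phi * phi
  else l * f phi * phi * (1 - U phi beta l).

Definition M1 (phi1 phi2 beta alpha : R) : R :=
  payoff phi1 phi2 (lambda1 phi1 phi2 beta alpha) beta alpha.

Definition M2 (phi1 phi2 beta alpha : R) : R :=
  payoff phi2 phi1 (lambda2 phi1 phi2 beta alpha) beta alpha.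

End Platforms.

Definition parameter_domain (R : realType) : set (R * R) :=
  [set p : R * R | 0 <= p.1 /\ 0 <= p.2 < 1].
Arguments parameter_domain R : clear implicits.

(* Main.v *)
Require Import Defs.
From mathcomp Require Import all_boot all_order all_algebra.
From mathcomp Require Import all_classical all_reals all_analysis.
From mathcomp Require Import ring lra.
Import Order.TTheory GRing.Theory Num.Theory.
Import numFieldNormedType.Exports.
Local Open Scope classical_set_scope.
Local Open Scope ring_scope.

Set Implicit Arguments.
Unset Strict Implicit.
Unset Printing Implicit Defensive.

(** With x = lambda f(phi), the idle probability U(x, beta) = 1 / S(x, beta)
    satisfies S(x, beta) = 1 + e / (x + beta) S(x + beta, beta). At beta = 0 the
    function max(0, 1 - e / x) solves the same equation, and unrolling the
    equation K times from this function and from 1 gives continuous lower and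
    upper bounds of U, both converging to U pointwise; hence U is jointly
    continuous up to beta = 0.

    If n has the law proportional to mu_n, then P(n > k) is the product of
    1 - U(x + a beta, beta) over a <= k. An Abel summation therefore expresses
    the delay through U alone: it is jointly continuous, nondecreasing in lambda,
    and strictly increasing wherever U > 0, since alpha < 1.

    When the two prices differ, the delay gap h(lambda) = D_1 - D_2 is negative
    before the Wardrop split and positive after it. This sign pattern determines
    the split, holds for beta = 0 as well, and passes to limits of the parameters
    by pointwise convergence of h. The payoff is x phi (1 - U(x, beta))
    throughout. *)

(** * The idle probability: summability, recursion and monotonicity *)

Section Idle.
Context {R : realType} (e : R).
Hypothesis e_gt0 : 0 < e.

(** [mu] in the single variable [x = l * f phi]; the two are convertible. *)
Definition weight (x b : R) (n : nat) : R :=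
  \prod_(1 <= a < n.+1) (e / (x + a%:R * b)).

(* 1 - e / x for x >= e, and 0 below; the maxima keep it continuous at x = 0. *)
Definition idle0 (x : R) : R := Num.max 0 (x - e) / Num.max e x.

(* The paper's U as a function of x = lambda * f phi. *)
Definition idle (x b : R) : R :=
  if b == 0 then idle0 x else (limn (series (weight x b)))^-1.

Lemma weight0 x b : weight x b 0 = 1.
Proof. by rewrite /weight big_nil. Qed.

Lemma weightS x b n : weight x b n.+1 = e / (x + b) * weight (x + b) b n.
Proof.
rewrite /weight big_nat_recl // mul1r; congr (_ * _).
apply: eq_bigr => i _.
by rewrite -[i.+1]addn1 natrD mulrDl mul1r -!addrA [b + _]addrC.
Qed.

Lemma weight_gt0 x b n : 0 <= x -> 0 < b -> 0 < weight x b n.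
Proof.
move=> x0 b0; rewrite /weight big_add1 /=; apply: prodr_gt0 => i _.
by rewrite divr_gt0 // ltr_wpDl // mulr_gt0.
Qed.

Lemma weight_le x x' b n : 0 <= x -> x <= x' -> 0 < b ->
  weight x' b n <= weight x b n.
Proof.
move=> x0 xx' b0; rewrite /weight !big_add1 /=; apply: ler_prod => i _.
have ib : 0 < i.+1%:R * b by rewrite mulr_gt0.
have x'0 : 0 <= x' by apply: le_trans xx'.
rewrite divr_ge0 ?(ltW e_gt0) ?addr_ge0 ?(ltW ib) //=.
rewrite ler_pM2l // lef_pV2 ?posrE ?ltr_wpDl //.
by rewrite lerD2r.
Qed.

(** At [x = 0] the weights are the exponential coefficients (e / b)^n / n!, and they decrease in
    [x]; this gives summability. *)
Lemma weight_le_exp_coeff x b n : 0 <= x -> 0 < b ->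
  weight x b n <= exp_coeff (e / b) n.
Proof.
move=> x0 b0; apply: (le_trans (weight_le n (lexx 0) x0 b0)).
suff -> : weight 0 b n = exp_coeff (e / b) n by [].
rewrite /exp_coeff /=; elim: n => [|n IH].
  by rewrite weight0 expr0 fact0 divr1.
rewrite {1}/weight big_nat_recr //= -/(weight 0 b n) IH exprS factS natrM.
by field; rewrite pnatr_eq0 -lt0n fact_gt0 gt_eqF ?gt_eqF // ltr_wpDr.
Qed.

Lemma cvg_weight x b : 0 <= x -> 0 < b -> cvgn (series (weight x b)).
Proof.
move=> x0 b0; apply: (series_le_cvg _ _ _ (is_cvg_series_exp_coeff (e / b))).
- by move=> n; rewrite ltW // weight_gt0.
- by move=> n; rewrite exp_coeff_ge0 // ltW // divr_gt0.
- by move=> n; exact: weight_le_exp_coeff.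
Qed.

Lemma series_weightS x b n : series (weight x b) n.+1 =
  1 + e / (x + b) * series (weight (x + b) b) n.
Proof.
rewrite !seriesEnat /= big_nat_recl // weight0; congr (_ + _).
by rewrite mulr_sumr; apply: eq_bigr => i _; rewrite weightS.
Qed.

Lemma lim_weight_ge1 x b : 0 <= x -> 0 < b -> 1 <= limn (series (weight x b)).
Proof.
move=> x0 b0.
have <- : series (weight x b) 1%N = 1.
  by rewrite seriesEnat /= big_nat1 weight0.
apply: nondecreasing_cvgn_le; last exact: cvg_weight.
by apply: nondecreasing_series => n _ _; exact/ltW/weight_gt0.
Qed.

Lemma lim_weight_step x b : 0 <= x -> 0 < b ->
  limn (series (weight x b)) =
  1 + e / (x + b) * limn (series (weight (x + b) b)).
Proof.
move=> x0 b0; apply/cvg_lim => //; rewrite -cvg_shiftS.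
under eq_fun do rewrite series_weightS.
apply: cvgD; first exact: cvg_cst.
by apply: cvgM; [exact: cvg_cst|apply: cvg_weight => //; rewrite addr_ge0 // ltW].
Qed.

Lemma idle_pos x b : 0 < b -> idle x b = (limn (series (weight x b)))^-1.
Proof. by move=> b0; rewrite /idle gt_eqF. Qed.

Lemma idle_gt0 x b : 0 <= x -> 0 < b -> 0 < idle x b.
Proof.
move=> x0 b0; rewrite idle_pos // invr_gt0.
exact: (lt_le_trans ltr01 (lim_weight_ge1 x0 b0)).
Qed.

Lemma idle0_le x : x <= e -> idle0 x = 0.
Proof. by move=> xe; rewrite /idle0 max_l ?mul0r // subr_le0. Qed.

Lemma idle0_ge x : e <= x -> idle0 x = 1 - e / x.
Proof.
move=> ex; have x0 : 0 < x := lt_le_trans e_gt0 ex.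
by rewrite /idle0 !max_r // ?subr_ge0 // mulrBl divff ?gt_eqF.
Qed.

Lemma idle0_gt0 x : e < x -> 0 < idle0 x.
Proof.
move=> ex; rewrite idle0_ge ?ltW // subr_gt0 ltr_pdivrMr ?mul1r //.
exact: lt_trans ex.
Qed.

Lemma idle0_ge0 x : 0 <= idle0 x.
Proof.
by have [/idle0_le ->//|/idle0_gt0/ltW] := leP x e.
Qed.

Lemma idle_b0 x : idle x 0 = idle0 x.
Proof. by rewrite /idle eqxx. Qed.

Lemma idle_ge0 x b : 0 <= x -> 0 <= b -> 0 <= idle x b.
Proof.
move=> x0; rewrite le_eqVlt => /predU1P[<-|b0]; last exact/ltW/idle_gt0.
by rewrite idle_b0 idle0_ge0.
Qed.

Lemma idle_le1 x b : 0 <= x -> 0 <= b -> idle x b <= 1.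
Proof.
move=> x0; rewrite le_eqVlt => /predU1P[<-|b0]; last first.
  rewrite idle_pos // invf_le1 ?lim_weight_ge1 //.
  exact: (lt_le_trans ltr01 (lim_weight_ge1 x0 b0)).
rewrite idle_b0; have [/idle0_le ->//|ex] := leP x e.
by rewrite idle0_ge ?(ltW ex) // gerBl divr_ge0 ?(ltW e_gt0) ?(ltW (lt_trans e_gt0 ex)).
Qed.

Lemma idle_le x x' b : 0 <= x -> x <= x' -> 0 <= b -> idle x b <= idle x' b.
Proof.
move=> x0 xx'; have x'0 := le_trans x0 xx'.
rewrite le_eqVlt => /predU1P[<-|b0]; last first.
  rewrite !idle_pos // lef_pV2 ?posrE; last 2 first.
  - exact: (lt_le_trans ltr01 (lim_weight_ge1 _ b0)).
  - exact: (lt_le_trans ltr01 (lim_weight_ge1 _ b0)).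
  by apply: lim_series_le => [||n]; [exact: cvg_weight..|exact: weight_le].
rewrite !idle_b0; have [/idle0_le ->|ex] := leP x e; first exact: idle0_ge0.
rewrite !idle0_ge ?(ltW ex) ?(le_trans (ltW ex)) //.
by rewrite lerB // ler_pM2l // lef_pV2 ?posrE // (lt_trans e_gt0) // (lt_le_trans ex).
Qed.

(** The reciprocal of S(x, b) = 1 + e / (x + b) S(x + b, b), cleared of the division by [x + b] so
    that it also holds at [x = b = 0]. *)
Lemma idle_step x b : 0 <= x -> 0 <= b ->
  idle x b = (x + b) * idle (x + b) b / ((x + b) * idle (x + b) b + e).
Proof.
move=> x0; rewrite le_eqVlt => /predU1P[<-|b0]; last first.
  have xb : 0 < x + b by rewrite ltr_wpDl.
  have S0 := lt_le_trans ltr01 (lim_weight_ge1 (ltW xb) b0).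
  rewrite !idle_pos // lim_weight_step //.
  by field; rewrite (gt_eqF S0) (gt_eqF xb) gt_eqF // addr_gt0 ?mulr_gt0.
rewrite addr0 idle_b0; have [/idle0_le ->|ex] := leP x e; first by rewrite mulr0 mul0r.
have x1 := lt_trans e_gt0 ex.
rewrite idle0_ge ?(ltW ex) // mulrBr mulr1 mulrCA divff ?gt_eqF // mulr1 subrK.
by rewrite mulrBl divff ?gt_eqF.
Qed.

(** Strictness comes from the factor [x + b] in the recursion, since s / (s + e) is strictly
    increasing in s. Positivity at [x'] excludes the flat part of [idle0]. *)
Lemma idle_lt x x' b : 0 <= x -> x < x' -> 0 <= b -> 0 < idle x' b ->
  idle x b < idle x' b.
Proof.
move=> x0 xx' b0 u0; have x'0 := le_lt_trans x0 xx'.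
have ub := idle_le (addr_ge0 x0 b0) (_ : x + b <= x' + b) b0.
have {ub} : idle (x + b) b <= idle (x' + b) b by rewrite ub // lerD2r ltW.
have : 0 <= idle (x + b) b by rewrite idle_ge0 // addr_ge0.
move: u0; rewrite (idle_step x0) // (idle_step (ltW x'0)) //.
set u := idle (x + b) b; set v := idle (x' + b) b => h u0 uv.
have t0 : 0 <= x + b by rewrite addr_ge0.
have xb' : 0 < x' + b by rewrite ltr_wpDr.
have v0 : 0 < v.
  rewrite lt_neqAle (le_trans u0 uv) andbT; apply/eqP => v0.
  by move: h; rewrite -v0 mulr0 mul0r ltxx.
have tuv : (x + b) * u < (x' + b) * v.
  apply: (@le_lt_trans _ _ ((x + b) * v)); first exact: ler_wpM2l.
  by rewrite ltr_pM2r // ltrD2r.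
set s := (x + b) * u in tuv *; set r := (x' + b) * v in tuv *.
have s0 : 0 <= s by rewrite mulr_ge0.
have se : 0 < s + e by rewrite ltr_wpDl.
have re : 0 < r + e by rewrite ltr_wpDl // ltW // (le_lt_trans s0).
rewrite ltr_pdivrMr // mulrAC ltr_pdivlMr // !mulrDr [r * s]mulrC ltrD2l.
by rewrite ltr_pM2r.
Qed.

(** Dropping a b from the denominators bounds the weights by (e / x)^n, so S is at most the
    geometric sum 1 / (1 - e / x) when [e < x]. *)
Lemma idle0_le_idle x b : 0 <= x -> 0 <= b -> idle0 x <= idle x b.
Proof.
move=> x0; rewrite le_eqVlt => /predU1P[<-|b0]; first by rewrite idle_b0.
have [/idle0_le ->|ex] := leP x e; first exact/ltW/idle_gt0.
have x1 := lt_trans e_gt0 ex.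
rewrite idle0_ge ?(ltW ex) // idle_pos // -[leLHS]invrK lef_pV2 ?posrE.
- have y1 : `|e / x| < 1.
    by rewrite gtr0_norm ?divr_gt0 // ltr_pdivrMr // mul1r.
  have cg := @cvg_geometric_series _ 1 _ y1.
  rewrite -[leRHS]mul1r -(cvg_lim _ cg) //.
  apply: lim_series_le => [||n]; [exact: cvg_weight|by apply: cvgP cg|].
  rewrite /geometric /= mul1r /weight big_add1 /= -[in leRHS](card_ord n).
  rewrite -prodr_const big_mkord; apply: ler_prod => i _.
  have ib : 0 < i.+1%:R * b by rewrite mulr_gt0.
  rewrite divr_ge0 ?(ltW e_gt0) ?addr_ge0 ?(ltW ib) //= ler_pM2l // lef_pV2 ?posrE ?ltr_wpDl //.
  by rewrite lerDl ltW.
- by rewrite invr_gt0 -idle0_ge ?ltW // idle0_gt0.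
- exact: (lt_le_trans ltr01 (lim_weight_ge1 x0 b0)).
Qed.
End Idle.

(** * Joint continuity of the idle probability up to [b = 0] *)

Section IdleContinuity.
Context {R : realType} (e : R).
Hypothesis e_gt0 : 0 < e.

(** [K] steps of the recursion of [idle_step], started from [g] at x + K b. *)
Fixpoint unroll (g : R -> R -> R) (K : nat) (x b : R) : R :=
  if K is K'.+1 then
    let t := x + b in
    t * unroll g K' t b / (t * unroll g K' t b + e)
  else g x b.

Definition nonneg_on_quadrant (g : R -> R -> R) :=
  forall x b, 0 <= x -> 0 <= b -> 0 <= g x b.

Lemma unroll_ge0 g K : nonneg_on_quadrant g -> nonneg_on_quadrant (unroll g K).
Proof.
move=> g0; elim: K => [|K IH] x b x0 b0 /=; first exact: g0.
have t0 : 0 <= x + b by rewrite addr_ge0.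
have u0 := mulr_ge0 t0 (IH _ _ t0 b0).
by rewrite divr_ge0 // addr_ge0 // ltW.
Qed.

Lemma unroll_le g g' K : nonneg_on_quadrant g ->
  (forall x b, 0 <= x -> 0 <= b -> g x b <= g' x b) ->
  forall x b, 0 <= x -> 0 <= b -> unroll g K x b <= unroll g' K x b.
Proof.
move=> g0 gg'; elim: K => [|K IH] x b x0 b0 /=; first exact: gg'.
have t0 : 0 <= x + b by rewrite addr_ge0.
have := unroll_ge0 K g0 t0 b0; have := IH _ _ t0 b0.
move: (unroll g K _ _) (unroll g' K _ _) => u v uv u0.
have tuv : (x + b) * u <= (x + b) * v by exact: ler_wpM2l.
have tu0 : 0 <= (x + b) * u by rewrite mulr_ge0.
move: tuv tu0; move: (_ * u) (_ * v) => s r sr s0.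
have se : 0 < s + e by rewrite ltr_wpDl.
have re : 0 < r + e by rewrite ltr_wpDl // (le_trans s0).
rewrite ler_pdivrMr // mulrAC ler_pdivlMr // !mulrDr [r * s]mulrC lerD2l.
by rewrite ler_pM2r.
Qed.

Lemma unroll_idle K x b : 0 <= x -> 0 <= b ->
  unroll (idle e) K x b = idle e x b.
Proof.
elim: K x => [//|K IH] x x0 b0 /=.
by rewrite IH ?addr_ge0 // -idle_step.
Qed.

Lemma unroll_cvg (T : Type) (F : set_system T) {FF : Filter F} g K
    (u v : T -> R) (x b : R) :
  nonneg_on_quadrant g ->
  (forall (u v : T -> R) x b, u @ F --> x -> v @ F --> b ->
    g (u t) (v t) @[t --> F] --> g x b) ->
  0 <= x -> 0 <= b -> u @ F --> x -> v @ F --> b ->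
  unroll g K (u t) (v t) @[t --> F] --> unroll g K x b.
Proof.
move=> g0 cg; elim: K u x => [|K IH] u x x0 b0 cu cv /=; first exact: cg.
have t0 : 0 <= x + b by rewrite addr_ge0.
have ct : u t + v t @[t --> F] --> x + b by exact: cvgD.
have cn := cvgM ct (IH (fun t => u t + v t) _ t0 b0 ct cv).
apply: cvgM; first exact: cn.
apply: cvgV; last by apply: cvgD; [exact: cn|exact: cvg_cst].
by rewrite gt_eqF // ltr_wpDl // mulr_ge0 // unroll_ge0.
Qed.

(** In reciprocals each step is affine: 1 / u becomes 1 + e / ((x + b) u). Hence [K] steps leave a
    partial sum of the weights and one remainder that carries [g]. *)
Lemma unroll_inv g K x b : 0 <= x -> 0 <= b -> 0 < x + b ->
  0 < g (x + K%:R * b) b ->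
  0 < unroll g K x b /\
  (unroll g K x b)^-1 =
    series (weight e x b) K + weight e x b K / g (x + K%:R * b) b.
Proof.
move=> x0 b0; elim: K x x0 => [|K IH] x x0 t0.
  by rewrite mul0r addr0 => g0; rewrite weight0 seriesEnat /= big_nil add0r mul1r.
have -> : x + K.+1%:R * b = (x + b) + K%:R * b by rewrite -natr1; ring.
move=> g0 /=.
have [u0 E] := IH _ (ltW t0) (ltr_wpDr b0 t0) g0.
have tu0 : 0 < (x + b) * unroll g K (x + b) b by rewrite mulr_gt0.
split; first by rewrite divr_gt0 // addr_gt0.
rewrite series_weightS weightS -addrA -[_ * weight _ _ _ _ / _]mulrA -mulrDr -E.
by field; rewrite (gt_eqF u0) (gt_eqF t0) gt_eqF // addr_gt0.
Qed.

Lemma weight_b0 x n : weight e x 0 n = (e / x) ^+ n.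
Proof.
rewrite /weight; under eq_bigr do rewrite mulr0 addr0.
by rewrite big_add1 /= big_mkord prodr_const card_ord.
Qed.

(** For [0 < x + b] the unrolling from 1 is the reciprocal of the partial sum with [K.+1] terms,
    which converges if [0 < b] or [e < x] and diverges if [b = 0] and [x <= e]. *)
Lemma upper_cvg x b : 0 <= x -> 0 <= b ->
  unroll (fun _ _ => 1) K x b @[K --> \oo] --> idle e x b.
Proof.
(* [unroll_inv] divides by [x + b]. At the origin every unrolling with at least one step is 0, hence
   the index shift. *)
move=> x0 b0; have [t0|] := ltP 0 (x + b); last first.
  move=> t0; have {t0} [-> ->] : x = 0 /\ b = 0 by lra.
  rewrite idle_b0 idle0_le ?(ltW e_gt0) // -cvg_shiftS /=.
  by under eq_fun do rewrite addr0 !mul0r; exact: cvg_cst.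
have unrollE K : unroll (fun _ _ => 1) K x b = (series (weight e x b) K.+1)^-1.
  have [|_ E] := @unroll_inv (fun _ _ => 1) K x b x0 b0 t0; first exact: ltr01.
  by rewrite -[LHS]invrK E divr1 -seriesSr.
have unroll_cvgE l : (series (weight e x b) n)^-1 @[n --> \oo] --> l ->
    unroll (fun _ _ => 1) K x b @[K --> \oo] --> l.
  by under [X in _ -> X @ _ --> _]eq_fun do rewrite unrollE; rewrite -cvg_shiftS.
move: b0; rewrite le_eqVlt => /predU1P[b0|b0]; last first.
  rewrite idle_pos //; apply: unroll_cvgE.
  apply: cvgV; last exact: cvg_weight.
  by rewrite gt_eqF // (lt_le_trans ltr01) // lim_weight_ge1.
subst b; rewrite addr0 in t0; rewrite idle_b0; have [xe|ex] := leP x e.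
  rewrite idle0_le //.
  apply: (squeeze_cvgr _ (cvg_cst 0) (@cvg_harmonic R)).
  near=> K; apply/andP; split.
    by apply: unroll_ge0 => // ? ? _ _; exact: ler01.
  (* All terms (e / x)^n are at least 1, so the reciprocal is at most 1 / (K + 1). *)
  have le_series : K.+1%:R <= series (weight e x 0) K.+1.
    rewrite seriesEnat /= -[K.+1 in leLHS]subn0 -sumr_const_nat.
    apply: ler_sum => i _; rewrite weight_b0 exprn_ege1 //.
    by rewrite ler_pdivlMr // mul1r.
  by rewrite unrollE lef_pV2 ?posrE // (lt_le_trans _ le_series).
rewrite idle0_ge ?(ltW ex) //; apply: unroll_cvgE.
have y1 : `|e / x| < 1.
  by rewrite gtr0_norm ?divr_gt0 // ltr_pdivrMr // mul1r.
have -> : weight e x 0 = geometric 1 (e / x).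
  by apply/funext => n; rewrite weight_b0 /geometric /= mul1r.
rewrite -[X in _ --> X]invrK -[(1 - e / x)^-1]div1r.
apply: cvgV; last exact: cvg_geometric_series.
by rewrite div1r invr_eq0 -idle0_ge ?(ltW ex) // gt_eqF // idle0_gt0.
Unshelve. all: by end_near. Qed.

(** By [unroll_inv] the reciprocal is a partial sum plus a remainder, the [K]-th weight over
    [idle0 e] at x + K b. Once x + K b passes 2 e this denominator is at least 1/2, so the remainder
    is at most twice a term of a convergent series. *)
Lemma lower_cvg x b : 0 <= x -> 0 < b ->
  unroll (fun x _ => idle0 e x) K x b @[K --> \oo] --> idle e x b.
Proof.
move=> x0 b0; rewrite idle_pos //.
have t0 : 0 < x + b by rewrite ltr_wpDl.
have big : \forall K \near \oo, 2 * e <= x + K%:R * b.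
  near=> K; rewrite ler_wpDl // -ler_pdivrMr //.
  by near: K; exact: nbhs_infty_ger.
have rate K : 2 * e <= x + K%:R * b -> 2^-1 <= idle0 e (x + K%:R * b).
  move: (x + _) => y ey; have y0 : 0 < y.
    by move: e_gt0 ey; lra.
  rewrite idle0_ge //; last lra.
  suff : e / y <= 2^-1 by lra.
  by rewrite ler_pdivrMr //; lra.
have E : \forall K \near \oo,
    (series (weight e x b) K + weight e x b K / idle0 e (x + K%:R * b))^-1 =
    unroll (fun x _ => idle0 e x) K x b.
  near=> K; have h := rate K (near big K _).
  have [|_ <-] := @unroll_inv (fun x _ => idle0 e x) K x b x0 (ltW b0) t0.
    by apply: lt_le_trans (h _); rewrite ?invr_gt0.
  by rewrite invrK.
apply: cvg_trans (near_eq_cvg E) _.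
apply: cvgV.
  by rewrite gt_eqF // (lt_le_trans ltr01) // lim_weight_ge1.
rewrite -[X in _ --> X]addr0; apply: cvgD; first exact: cvg_weight.
have w0 := cvg_series_cvg_0 (cvg_weight e_gt0 x0 b0).
have w20 : weight e x b K * 2 @[K --> \oo] --> 0.
  by rewrite -[X in _ --> X](mul0r 2); apply: cvgM => //; exact: cvg_cst.
apply: (squeeze_cvgr _ (cvg_cst 0) w20).
near=> K; have h := rate K (near big K _).
have w1 := weight_gt0 e_gt0 K x0 b0.
rewrite divr_ge0 ?(ltW w1) ?idle0_ge0 //= ler_pM2l //.
rewrite -[leRHS]invrK lef_pV2 ?posrE ?invr_gt0 ?h //.
by apply: lt_le_trans (h _); rewrite ?invr_gt0.
Unshelve. all: by end_near. Qed.

Lemma idle0_cvg (T : Type) (F : set_system T) {FF : Filter F} (u : T -> R) x :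
  u @ F --> x -> idle0 e (u t) @[t --> F] --> idle0 e x.
Proof.
move=> cu; apply: continuous_cvg cu.
apply: continuousM; first apply: continuous_max.
- exact: cvg_cst.
- by apply: cvgB; [exact: cvg_id|exact: cvg_cst].
- apply: cvgV; first by rewrite gt_eqF // lt_max e_gt0.
  by apply: continuous_max; [exact: cvg_cst|exact: cvg_id].
Qed.

(** [K] and [L] are chosen at the limit point so that both bounds are within [eps] of [idle e x b];
    the continuity of these two fixed bounds then controls the nearby values. *)
Lemma idle_cvg (T : Type) (F : set_system T) {FF : Filter F}
    (u v : T -> R) (x b : R) : 0 <= x -> 0 <= b ->
  (\forall t \near F, 0 <= u t /\ 0 <= v t) -> u @ F --> x -> v @ F --> b ->
  idle e (u t) (v t) @[t --> F] --> idle e x b.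
Proof.
move=> x0 b0 uv0 cu cv; apply/cvgrPdist_lt => eps eps0.
have [K hK] : exists K, idle e x b - eps < unroll (fun x _ => idle0 e x) K x b.
  move: b0; rewrite le_eqVlt => /predU1P[b0|b0].
    (* At [b = 0] the lower bound with [K = 0] is already exact. *)
    by exists 0%N; rewrite -b0 idle_b0 /= ltrBlDr ltrDl.
  have : \forall K \near \oo, idle e x b - eps < unroll (fun x _ => idle0 e x) K x b.
    by apply: cvgr_gt; [exact: (lower_cvg x0 b0)|rewrite ltrBlDr ltrDl].
  by move/filter_ex.
have [L hL] : exists L, unroll (fun _ _ => 1) L x b < idle e x b + eps.
  have : \forall K \near \oo, unroll (fun _ _ => 1) K x b < idle e x b + eps.
    by apply: cvgr_lt; [exact: (upper_cvg x0 b0)|rewrite ltrDl].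
  by move/filter_ex.
have g0 : nonneg_on_quadrant (fun x _ => idle0 e x).
  by move=> ? ? _ _; exact: idle0_ge0.
have g1 : nonneg_on_quadrant (fun _ _ => 1) by move=> ? ? _ _; exact: ler01.
have cK : unroll (fun x _ => idle0 e x) K (u t) (v t) @[t --> F] -->
    unroll (fun x _ => idle0 e x) K x b.
  by apply: unroll_cvg => // u' v' x' b' cu' _; exact: idle0_cvg.
have cL : unroll (fun _ _ => 1) L (u t) (v t) @[t --> F] -->
    unroll (fun _ _ => 1) L x b.
  by apply: unroll_cvg => // *; exact: cvg_cst.
near=> t.
have [ut vt] : 0 <= u t /\ 0 <= v t by near: t.
have lo : unroll (fun x _ => idle0 e x) K (u t) (v t) <= idle e (u t) (v t).
  rewrite -(unroll_idle K ut vt); apply: unroll_le => //.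
  exact: idle0_le_idle.
have up : idle e (u t) (v t) <= unroll (fun _ _ => 1) L (u t) (v t).
  rewrite -(unroll_idle L ut vt); apply: unroll_le => //; last exact: idle_le1.
  exact: idle_ge0.
have hK' : idle e x b - eps < unroll (fun x _ => idle0 e x) K (u t) (v t).
  by near: t; exact: cvgr_gt cK _ hK.
have hL' : unroll (fun _ _ => 1) L (u t) (v t) < idle e x b + eps.
  by near: t; exact: cvgr_lt cL _ hL.
rewrite ltr_norml; lra.
Unshelve. all: by end_near. Qed.
End IdleContinuity.

(** * The delay through the idle probability: one formula for all [beta >= 0] *)

Section DelayFactor.
Context {R : realType} (e : R) (N : nat).
Hypothesis e_gt0 : 0 < e.

(* For b > 0, the probability of {n | k < n} under the law proportional to
   weight x b. *)
Definition tail (x b : R) (k : nat) : R :=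
  \prod_(a < k.+1) (1 - idle e (x + a%:R * b) b).

(** The expression that [D] multiplies by [f phi]. For [b > 0] the difference of tails is the
    probability of n + 1; written through [idle] alone, it also makes sense at [b = 0]. *)
Definition delay_factor (x b alpha : R) : R :=
  idle e x b + alpha * \sum_(n < N) (tail x b n - tail x b n.+1) / n.+1%:R.

Lemma tail0 x b : tail x b 0 = 1 - idle e x b.
Proof. by rewrite /tail big_ord_recl big_ord0 mulr1 mul0r addr0. Qed.

Lemma tailS x b k : tail x b k.+1 = (1 - idle e x b) * tail (x + b) b k.
Proof.
rewrite /tail big_ord_recl mul0r addr0; congr (_ * _); apply: eq_bigr => i _.
by congr (1 - idle e _ b); rewrite lift0 -natr1; ring.
Qed.

(** By the recursion 1 - U(x) = e / (x + b) S(x + b) / S(x), and this factor turns the tail at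
    [x + b] into the tail at [x]. *)
Lemma tail_weight x b k : 0 <= x -> 0 < b ->
  tail x b k =
    1 - series (weight e x b) k.+1 / limn (series (weight e x b)).
Proof.
move=> + b0; elim: k x => [|k IH] x x0.
  by rewrite tail0 idle_pos // seriesEnat /= big_nat1 weight0 mul1r.
have t0 : 0 < x + b by rewrite ltr_wpDl.
have S0 := lt_le_trans ltr01 (lim_weight_ge1 e_gt0 (ltW t0) b0).
rewrite tailS IH ?(ltW t0) // idle_pos // lim_weight_step //.
rewrite [in RHS]series_weightS.
by field; rewrite (gt_eqF S0) (gt_eqF t0) gt_eqF // addr_gt0 // mulr_gt0.
Qed.

Lemma tail_weight_diff x b k : 0 <= x -> 0 < b ->
  tail x b k - tail x b k.+1 =
    weight e x b k.+1 / limn (series (weight e x b)).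
Proof.
move=> x0 b0; rewrite !tail_weight // [series _ k.+2]seriesSr.
by rewrite mulrDl; ring.
Qed.

Lemma tail_b0_low x k : x <= e -> tail x 0 k = 1.
Proof.
move=> xe; rewrite /tail big1 // => i _.
by rewrite mulr0 addr0 idle_b0 idle0_le // subr0.
Qed.

Lemma tail_b0_high x k : e < x -> tail x 0 k = (e / x) ^+ k.+1.
Proof.
move=> ex; rewrite /tail (eq_bigr (fun=> e / x)) => [|i _].
  by rewrite prodr_const card_ord.
by rewrite mulr0 addr0 idle_b0 idle0_ge ?(ltW ex) // subKr.
Qed.

Lemma tail_le x x' b k : 0 <= x -> x <= x' -> 0 <= b ->
  tail x' b k <= tail x b k.
Proof.
move=> x0 xx' b0; apply: ler_prod => i _.
have ib : 0 <= i%:R * b by rewrite mulr_ge0.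
have xi : 0 <= x + i%:R * b by rewrite addr_ge0.
have xi' : x + i%:R * b <= x' + i%:R * b by rewrite lerD2r.
apply/andP; split; first by rewrite subr_ge0 idle_le1 // (le_trans xi).
by apply: lerB => //; exact: idle_le.
Qed.

(** Only [b = 0] with [x <= e] can occur; there all tails are 1 and their differences vanish. *)
Lemma delay_factor_idle0 x b alpha : 0 <= x -> 0 <= b -> idle e x b = 0 ->
  delay_factor x b alpha = 0.
Proof.
move=> x0; rewrite le_eqVlt => /predU1P[<-|b0 h]; last first.
  by have := idle_gt0 e_gt0 x0 b0; rewrite h ltxx.
move=> h; have xe : x <= e.
  by rewrite leNgt; apply/negP => /(idle0_gt0 e_gt0); rewrite -idle_b0 h ltxx.
rewrite /delay_factor h big1 ?mulr0 ?addr0 // => i _.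
by rewrite !tail_b0_low // subrr mul0r.
Qed.

(** Summation by parts gives each inner [d k] the coefficient 1 / (k + 1) - 1 / k <= 0, so only
    [d 0] contributes positively. Keeping the last term in the bound closes the induction. *)
Lemma abel_sum_le (d : nat -> R) (n : nat) : (forall k, 0 <= d k) ->
  \sum_(k < n) (d k - d k.+1) / k.+1%:R <= d 0%N - d n / n.+1%:R.
Proof.
move=> d0; elim: n => [|n IH]; first by rewrite big_ord0 divr1 subrr.
rewrite big_ord_recr /=; apply: le_trans (lerD IH (lexx _)) _.
rewrite mulrBl addrA subrK lerB // ler_wpM2l // lef_pV2 ?posrE //.
by rewrite ler_nat.
Qed.

(** Raising [x] lowers every tail. With [d] this loss, the idle part gains [d 0] and the [alpha]
    part loses at most [alpha * d 0] by [abel_sum_le]. *)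
Lemma delay_factor_increment x x' b alpha :
  0 <= x -> x <= x' -> 0 <= b -> 0 <= alpha ->
  (1 - alpha) * (idle e x' b - idle e x b) <=
    delay_factor x' b alpha - delay_factor x b alpha.
Proof.
move=> x0 xx' b0 a0; pose d k := tail x b k - tail x' b k.
have d0 k : 0 <= d k by rewrite subr_ge0 tail_le.
have -> : idle e x' b - idle e x b = d 0%N by rewrite /d !tail0; ring.
have -> : delay_factor x' b alpha - delay_factor x b alpha =
    d 0%N - alpha * \sum_(k < N) (d k - d k.+1) / k.+1%:R.
  have -> : \sum_(k < N) (d k - d k.+1) / k.+1%:R =
      \sum_(k < N) (tail x b k - tail x b k.+1) / k.+1%:R -
      \sum_(k < N) (tail x' b k - tail x' b k.+1) / k.+1%:R.
    by rewrite -sumrB; apply: eq_bigr => i _; rewrite /d; ring.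
  by rewrite /delay_factor /d !tail0; ring.
rewrite mulrBl mul1r lerB // ler_wpM2l //.
by apply: le_trans (abel_sum_le N d0) _; rewrite gerBl divr_ge0.
Qed.

Lemma delay_factor_le x x' b alpha :
  0 <= x -> x <= x' -> 0 <= b -> 0 <= alpha < 1 ->
  delay_factor x b alpha <= delay_factor x' b alpha.
Proof.
move=> x0 xx' b0 /andP[a0 a1].
rewrite -subr_ge0; apply: le_trans (delay_factor_increment x0 xx' b0 a0).
by rewrite mulr_ge0 // subr_ge0 ?(ltW a1) // idle_le.
Qed.

Lemma delay_factor_lt x x' b alpha :
  0 <= x -> x < x' -> 0 <= b -> 0 <= alpha < 1 -> 0 < idle e x' b ->
  delay_factor x b alpha < delay_factor x' b alpha.
Proof.
move=> x0 xx' b0 /andP[a0 a1] u0.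
rewrite -subr_gt0.
apply: lt_le_trans (delay_factor_increment x0 (ltW xx') b0 a0).
by rewrite mulr_gt0 // subr_gt0 // idle_lt.
Qed.

Lemma tail_cvg (T : Type) (F : set_system T) {FF : Filter F}
    (u v : T -> R) (x b : R) k : 0 <= x -> 0 <= b ->
  (\forall t \near F, 0 <= u t /\ 0 <= v t) -> u @ F --> x -> v @ F --> b ->
  tail (u t) (v t) k @[t --> F] --> tail x b k.
Proof.
move=> + b0; elim: k u x => [|k IH] u x x0 uv0 cu cv.
  under eq_fun do rewrite tail0.
  by rewrite tail0; apply: cvgB; [exact: cvg_cst|exact: idle_cvg].
under eq_fun do rewrite tailS.
rewrite tailS; apply: cvgM.
  by apply: cvgB; [exact: cvg_cst|exact: idle_cvg].
apply: (IH (fun t => u t + v t)); [exact: addr_ge0| |exact: cvgD|exact: cv].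
by apply: filterS uv0 => t [ut vt]; rewrite addr_ge0.
Qed.

Lemma cvg_sum_ord (T : Type) (F : set_system T) {FF : Filter F} n
    (u : nat -> T -> R) (l : nat -> R) :
  (forall i, u i @ F --> l i) ->
  \sum_(i < n) u i t @[t --> F] --> \sum_(i < n) l i.
Proof.
move=> ul; elim: n => [|n IH].
  by under eq_fun do rewrite big_ord0; rewrite big_ord0; exact: cvg_cst.
under eq_fun do rewrite big_ord_recr.
by rewrite big_ord_recr; apply: cvgD; [exact: IH|exact: ul].
Qed.

Lemma delay_factor_cvg (T : Type) (F : set_system T) {FF : Filter F}
    (u v w : T -> R) (x b alpha : R) : 0 <= x -> 0 <= b ->
  (\forall t \near F, 0 <= u t /\ 0 <= v t) ->
  u @ F --> x -> v @ F --> b -> w @ F --> alpha ->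
  delay_factor (u t) (v t) (w t) @[t --> F] --> delay_factor x b alpha.
Proof.
move=> x0 b0 uv0 cu cv cw; apply: cvgD; first exact: idle_cvg.
apply: cvgM => //.
apply: (@cvg_sum_ord _ _ _ _
  (fun n t => (tail (u t) (v t) n - tail (u t) (v t) n.+1) / n.+1%:R)
  (fun n => (tail x b n - tail x b n.+1) / n.+1%:R)) => n.
by apply: cvgMl; apply: cvgB; exact: tail_cvg.
Qed.

(** At [b = 0] the indicator in [D_zero] is the positivity of [idle0], and the geometric tails give
    n the probability (e / x)^n (1 - e / x). For [b > 0], [tail_weight_diff] recovers the normalized
    [mu]. *)
Lemma D_delay_factor (f : R -> R) phi b alpha l :
  0 < f phi -> 0 <= l -> 0 <= b ->
  D f e N phi b alpha l =
    1 - f phi + f phi * delay_factor (l * f phi) b alpha.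
Proof.
move=> f_gt0 l0; rewrite le_eqVlt => /predU1P[<-|b0].
  rewrite /D eqxx /D_zero; congr (_ + _).
  have x0 : 0 <= l * f phi by rewrite mulr_ge0 // ltW.
  have [xe|ex] := leP (l * f phi) e.
    rewrite delay_factor_idle0 // ?idle_b0 ?idle0_le // mulr0.
    case: ltP => //= l1; rewrite ltNge ler_pdivlMr ?mulr_gt0 // mul1r xe //.
  have x1 := lt_trans e_gt0 ex.
  have l1 : 0 < l by rewrite -(pmulr_lgt0 _ f_gt0).
  rewrite l1 ltr_pdivrMr // mul1r ex /= -mulrA; congr (_ * _).
  rewrite /delay_factor idle_b0 idle0_ge ?(ltW ex) //.
  rewrite mulrDr mulr1 mulrCA; congr (_ + _ * _).
  rewrite big_add1 /= big_mkord mulr_sumr; apply: eq_bigr => i _.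
  by rewrite !tail_b0_high // [_ ^+ i.+2]exprS; ring.
rewrite /D gt_eqF // /D_pos /B /U /delay_factor idle_pos //.
rewrite -[mu f e phi b l]/(weight e (l * f phi) b).
have -> : \sum_(n < N) (tail (l * f phi) b n - tail (l * f phi) b n.+1) / n.+1%:R =
    (\sum_(1 <= n < N.+1) mu f e phi b l n / n%:R) /
    limn (series (weight e (l * f phi) b)).
  rewrite big_add1 /= big_mkord mulr_suml; apply: eq_bigr => i _.
  by rewrite tail_weight_diff ?mulr_ge0 ?(ltW f_gt0) //; exact: mulrAC.
ring.
Qed.
End DelayFactor.

(** * Sign changes of a monotone function, their limits, and the minimizer of the square *)

Section Crossing.
Context {R : realType} (Lambda : R).

(** Only signs away from [l0] are prescribed, because the split may lie at an end of the interval,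
    where [h] need not vanish. *)
Definition crossing (h : R -> R) (l0 : R) : Prop :=
  0 <= l0 <= Lambda /\ forall l, 0 <= l <= Lambda ->
    (l < l0 -> h l < 0) /\ (l0 < l -> 0 < h l).

(** Strictness is asked only where [h] is nonpositive: at [beta = 0], with the first platform the
    more expensive one, the gap is a positive constant on the rates where both idle probabilities
    vanish. *)
Definition strict_below0 (h : R -> R) : Prop :=
  forall l l', 0 <= l -> l < l' -> l' <= Lambda ->
    h l <= h l' /\ (h l <= 0 -> h l < h l').

Definition constrained_zero (h : R -> R) (l0 : R) : Prop :=
  h l0 = 0 \/ (l0 = 0 /\ 0 <= h 0) \/ (l0 = Lambda /\ h Lambda <= 0).

Lemma constrained_zero_crossing h l0 : strict_below0 h -> 0 <= l0 <= Lambda ->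
  constrained_zero h l0 -> crossing h l0.
Proof.
move=> sh /andP[l00 l0L] hl0; split; first by rewrite l00.
move=> l /andP[lge0 lL]; split=> ll0.
  have [h1 h2] := sh _ _ lge0 ll0 l0L.
  case: hl0 => [E|[[E _]|[E EL]]]; last 2 first.
  - by move: ll0; rewrite E ltNge lge0.
  - rewrite E in h1 h2; have h3 := le_trans h1 EL.
    exact: lt_le_trans (h2 h3) EL.
  by rewrite E in h1 h2; exact: h2.
have [h1 h2] := sh _ _ l00 ll0 lL.
case: hl0 => [E|[[E E0]|[E _]]].
- by rewrite -E; apply: h2; rewrite E.
- rewrite E in h1 h2; have [/h2|h3] := leP (h 0) 0; first exact: le_lt_trans.
  exact: lt_le_trans h1.
- by move: ll0; rewrite E ltNge lL.
Qed.

Lemma crossing_unique h l0 l1 : crossing h l0 -> crossing h l1 -> l0 = l1.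
Proof.
wlog l01 : l0 l1 / l0 < l1 => [wl c0 c1|].
  by have [/wl->//|/wl->//|] := ltgtP l0 l1.
move=> [/andP[a0 aL] c0] [/andP[b0 bL] c1].
have m : 0 <= (l0 + l1) / 2 <= Lambda by apply/andP; split; lra.
have p : 0 < h ((l0 + l1) / 2) by apply: (c0 _ m).2; lra.
have n : h ((l0 + l1) / 2) < 0 by apply: (c1 _ m).1; lra.
by have := lt_trans p n; rewrite ltxx.
Qed.

(** Two test points l0 - eps / 2 and l0 + eps / 2 suffice: [h0] has a strict sign there, [h t]
    eventually inherits it, and this confines the crossing of [h t]. A test point outside the
    interval makes its bound trivial. *)
Lemma crossing_cvg (T : Type) (F : set_system T) {FF : Filter F}
    (h : T -> R -> R) (h0 : R -> R) (L : T -> R) (l0 : R) :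
  (\forall t \near F, crossing (h t) (L t)) -> crossing h0 l0 ->
  (forall l, 0 <= l <= Lambda -> h t l @[t --> F] --> h0 l) ->
  L @ F --> l0.
Proof.
move=> ch [/andP[l00 l0L] c0] hc; apply/cvgrPdist_lt => eps eps0.
have lo : \forall t \near F, l0 - eps < L t.
  have [l_neg|l_ge0] := ltP (l0 - eps / 2) 0.
    by apply: filterS ch => t [/andP[Lt0 _] _]; lra.
  have lI : 0 <= l0 - eps / 2 <= Lambda by apply/andP; split; lra.
  have hn : h0 (l0 - eps / 2) < 0 by apply: (c0 _ lI).1; lra.
  near=> t; have [_ ct] : crossing (h t) (L t) by near: t.
  have htn : h t (l0 - eps / 2) < 0 by near: t; exact: (cvgr_lt _ (hc _ lI)).
  have : ~ (L t < l0 - eps / 2).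
    by move=> /(ct _ lI).2 /(lt_trans htn); rewrite ltxx.
  by move/negP; rewrite -leNgt; lra.
have up : \forall t \near F, L t < l0 + eps.
  have [l_big|l_leL] := ltP Lambda (l0 + eps / 2).
    by apply: filterS ch => t [/andP[_ LtL] _]; lra.
  have lI : 0 <= l0 + eps / 2 <= Lambda by apply/andP; split; lra.
  have hp : 0 < h0 (l0 + eps / 2) by apply: (c0 _ lI).2; lra.
  near=> t; have [_ ct] : crossing (h t) (L t) by near: t.
  have htp : 0 < h t (l0 + eps / 2) by near: t; exact: (cvgr_gt _ (hc _ lI)).
  have : ~ (l0 + eps / 2 < L t).
    by move=> /(ct _ lI).1 /(lt_trans htp); rewrite ltxx.
  by move/negP; rewrite -leNgt; lra.
apply: filterS2 lo up => t lo up; rewrite ltr_norml; lra.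
Unshelve. all: by end_near. Qed.

(* When the minimizer is not unique, unique_argmin defaults to 0; under
   strict_below0 this happens only if 0 < h 0, and then 0 is the crossing. *)
Lemma crossing_argmin h : 0 <= Lambda -> strict_below0 h ->
  {within `[0, Lambda], continuous h} ->
  crossing h (unique_argmin Lambda (fun l => h l ^+ 2)).
Proof.
move=> L0 sh ch.
have [l0 l0I hl0] : exists2 l0, 0 <= l0 <= Lambda & constrained_zero h l0.
  have [h0|h0] := leP 0 (h 0); first by exists 0; [rewrite lexx|right; left].
  have [hL|hL] := leP (h Lambda) 0.
    by exists Lambda; [rewrite L0 lexx|right; right].
  have [|c cI hc] := IVT L0 ch (v := 0).
    by rewrite ge_min le_max (ltW h0) (ltW hL) orbT.
  by exists c; [rewrite in_itv in cI|left].
have cr := constrained_zero_crossing sh l0I hl0.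
have l0min : argmin Lambda (fun l => h l ^+ 2) l0.
  split=> // l lI; case: hl0 => [->|[[E E0]|[E EL]]].
  - by rewrite expr0n sqr_ge0.
  - rewrite E; move: lI => /andP[]; rewrite le_eqVlt => /predU1P[<-//|l1 lL].
    have [h1 _] := sh _ _ (lexx 0) l1 lL.
    by rewrite lerXn2r // nnegrE // (le_trans E0).
  - rewrite E; move: lI => /andP[l1]; rewrite le_eqVlt => /predU1P[->//|lL].
    have [h1 _] := sh _ _ l1 lL (lexx _).
    rewrite -[leLHS]sqrrN -[leRHS]sqrrN lerXn2r ?nnegrE ?oppr_ge0 ?lerN2 //.
    exact: le_trans h1 EL.
suff -> : unique_argmin Lambda (fun l => h l ^+ 2) = l0 by [].
rewrite /unique_argmin; case: xgetP => [x _ /= E|nuniq].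
  by move: l0min; rewrite E.
apply/esym/eqP; apply: contrapT => /eqP l0n0; apply: (nuniq l0) => /=.
apply/seteqP; split=> [l [lI lmin]|l ->//] /=.
have sq : h l ^+ 2 = h l0 ^+ 2.
  by apply/eqP; rewrite eq_le lmin //= l0min.2.
have sg := cr.2 _ lI.
case: hl0 => [E|[[E _]|[E EL]]].
- move: sq; rewrite E expr0n => /eqP; rewrite sqrf_eq0 => /eqP hl.
  by have [/sg.1|/sg.2|//] := ltgtP l l0; rewrite hl ltxx.
- by rewrite E eqxx in l0n0.
- move: lI => /andP[l1]; rewrite le_eqVlt => /predU1P[->//|lL].
  have [h1 h2] := sh _ _ l1 lL (lexx _).
  have h3 := le_trans h1 EL; have h4 := h2 h3.
  rewrite E in sq; have : h Lambda ^+ 2 < h l ^+ 2; last by rewrite sq ltxx.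
  by rewrite -[ltLHS]sqrrN -[ltRHS]sqrrN ltrXn2r ?nnegrE ?oppr_ge0 ?ltrN2.
Qed.
End Crossing.

(** * The delay gap as a function of the first platform's rate *)

Section Gap.
Context {R : realType} (f : R -> R) (Lambda e : R) (N : nat).
Hypothesis e_gt0 : 0 < e.
Hypothesis Lambda_gt0 : 0 < Lambda.

Definition gap (phi1 phi2 b alpha l : R) : R :=
  D f e N phi1 b alpha l - D f e N phi2 b alpha (Lambda - l).

(** The gap grows strictly if platform 1 has positive idle probability at [l'] or platform 2 at
    [Lambda - l]. If both vanish, the gap at [l] is f(phi2) - f(phi1): then [0 < b] is impossible,
    and [f phi1 < f phi2] contradicts a nonpositive gap. *)
Lemma gap_strict_below0 phi1 phi2 b alpha : 0 < f phi1 -> 0 < f phi2 ->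
  0 <= b -> 0 <= alpha < 1 -> 0 < b \/ f phi1 < f phi2 ->
  strict_below0 Lambda (gap phi1 phi2 b alpha).
Proof.
move=> f1 f2 b0 a01 bf l l' l0 ll' l'L.
have l'0 : 0 <= l' by lra.
have r0 : 0 <= Lambda - l by lra.
have r'0 : 0 <= Lambda - l' by lra.
rewrite /gap !D_delay_factor //.
set x := l * f phi1; set x' := l' * f phi1.
set y := (Lambda - l) * f phi2; set y' := (Lambda - l') * f phi2.
have x0 : 0 <= x by rewrite mulr_ge0 // ltW.
have x'0 : 0 <= x' by rewrite mulr_ge0 // ltW.
have y0 : 0 <= y by rewrite mulr_ge0 // ltW.
have y'0 : 0 <= y' by rewrite mulr_ge0 // ltW.
have xx' : x < x' by rewrite ltr_pM2r.
have yy' : y' < y by rewrite ltr_pM2r //; lra.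
have dx := delay_factor_le N e_gt0 x0 (ltW xx') b0 a01.
have dy := delay_factor_le N e_gt0 y'0 (ltW yy') b0 a01.
have fx := ler_wpM2l (ltW f1) dx.
have fy := ler_wpM2l (ltW f2) dy.
split; first lra.
move=> neg.
have : 0 <= idle e x' b by exact: idle_ge0.
rewrite le_eqVlt => /predU1P[ux|ux]; last first.
  have := delay_factor_lt N e_gt0 x0 xx' b0 a01 ux.
  by rewrite -(ltr_pM2l f1); lra.
have : 0 <= idle e y b by exact: idle_ge0.
rewrite le_eqVlt => /predU1P[uy|uy]; last first.
  have := delay_factor_lt N e_gt0 y'0 yy' b0 a01 uy.
  by rewrite -(ltr_pM2l f2); lra.
have ux0 : idle e x b = 0.
  apply/eqP; rewrite eq_le idle_ge0 // andbT ux.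
  by apply: idle_le => //; exact: ltW.
move: neg; rewrite (delay_factor_idle0 N e_gt0 alpha x0 b0 ux0).
rewrite (delay_factor_idle0 N e_gt0 alpha y0 b0 (esym uy)) !mulr0.
case: bf => [b1|]; last lra.
by have := idle_gt0 e_gt0 x0 b1; rewrite ux0 ltxx.
Qed.

(** The rate may move along with the parameters, so this serves both for continuity in [l] and, with
    [l] fixed, for limits in the parameters. *)
Lemma gap_cvg (T : Type) (F : set_system T) {FF : Filter F} phi1 phi2
    (u v w : T -> R) (b alpha l : R) : 0 < f phi1 -> 0 < f phi2 ->
  0 <= b -> 0 <= l <= Lambda ->
  (\forall t \near F, 0 <= u t /\ 0 <= v t <= Lambda) ->
  u @ F --> b -> v @ F --> l -> w @ F --> alpha ->
  gap phi1 phi2 (u t) (w t) (v t) @[t --> F] --> gap phi1 phi2 b alpha l.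
Proof.
move=> f1 f2 b0 /andP[l0 lL] uv cu cv cw.
have r0 : 0 <= Lambda - l by rewrite subr_ge0.
rewrite /gap !D_delay_factor //.
have E : \forall t \near F,
    (1 - f phi1 + f phi1 * delay_factor e N (v t * f phi1) (u t) (w t)) -
    (1 - f phi2 + f phi2 * delay_factor e N ((Lambda - v t) * f phi2) (u t) (w t))
    = D f e N phi1 (u t) (w t) (v t) - D f e N phi2 (u t) (w t) (Lambda - v t).
  apply: filterS uv => t [ut /andP[vt vtL]].
  by rewrite !D_delay_factor // subr_ge0.
apply: cvg_trans (near_eq_cvg E) _.
apply: cvgB; (apply: cvgD; first exact: cvg_cst); apply: cvgMr;
    apply: delay_factor_cvg => //.
- by rewrite mulr_ge0 // ltW.
- by apply: filterS uv => t [ut /andP[vt _]]; rewrite mulr_ge0 // ltW.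
- exact: cvgMl.
- by rewrite mulr_ge0 // ltW.
- apply: filterS uv => t [ut /andP[_ vt]].
  by rewrite mulr_ge0 ?subr_ge0 // ltW.
- by apply: cvgMl; apply: cvgB => //; exact: cvg_cst.
Qed.

Lemma gap_continuous phi1 phi2 b alpha : 0 < f phi1 -> 0 < f phi2 -> 0 <= b ->
  {within `[0, Lambda], continuous (gap phi1 phi2 b alpha)}.
Proof.
move=> f1 f2 b0; apply/subspace_continuousP => l /= lI.
rewrite in_itv /= in lI.
apply: (gap_cvg (u := fun=> b) (v := id) (w := fun=> alpha)) => //.
- near=> t; split=> //.
  have : (`[0, Lambda]%classic : set R) t by near: t; exact: withinT.
  by rewrite /= in_itv.
- exact: cvg_cst.
- exact: cvg_within.
- exact: cvg_cst.
Unshelve. all: by end_near. Qed.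

Lemma lambda_star_crossing phi1 phi2 b alpha : 0 < f phi1 -> 0 < f phi2 ->
  0 <= b -> 0 <= alpha < 1 -> 0 < b \/ f phi1 < f phi2 ->
  crossing Lambda (gap phi1 phi2 b alpha)
    (lambda_star f Lambda e N phi1 phi2 b alpha).
Proof.
move=> f1 f2 b0 a01 bf; apply: crossing_argmin; first exact: ltW.
  exact: gap_strict_below0.
exact: gap_continuous.
Qed.

Lemma gap_swap phi1 phi2 b alpha l :
  gap phi2 phi1 b alpha (Lambda - l) = - gap phi1 phi2 b alpha l.
Proof. by rewrite /gap subKr opprB. Qed.

(** Interchanging the platforms reflects the rate and reverses the sign of the gap; this carries
    results for [phi2 < phi1] over to [phi1 < phi2]. *)
Lemma crossing_gap_swap phi1 phi2 b alpha l :
  crossing Lambda (gap phi1 phi2 b alpha) l ->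
  crossing Lambda (gap phi2 phi1 b alpha) (Lambda - l).
Proof.
move=> [/andP[l0 lL] c]; split; first by apply/andP; split; lra.
move=> m /andP[m0 mL]; have mI : 0 <= Lambda - m <= Lambda.
  by apply/andP; split; lra.
have [c1 c2] := c _ mI; move: c1 c2.
rewrite -[m in gap phi2 _ _ _ m](subKr Lambda) (gap_swap phi1).
rewrite oppr_lt0 oppr_gt0 => c1 c2.
by split=> h; [apply: c2|apply: c1]; lra.
Qed.
End Gap.

(** Makes the intermediate value theorem available for [f]: the convergent difference quotient times
    y - x tends to 0. *)
Lemma differentiable_on_continuous (R : realType) (a b : R) (f : R -> R) :
  differentiable_on a b f -> {within `[a, b], continuous f}.
Proof.
move=> df; apply/subspace_continuousP => x /=; rewrite in_itv /= => xab.
have /cvg_ex[/= l dl] := df x xab.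
have c0 : (y - x) @[y --> within [set z : R | a <= z <= b] x^'] --> 0.
  rewrite -(subrr x); apply: cvgB; last exact: cvg_cst.
  by apply: cvg_within_filter; exact: nbhs_dnbhs.
have : (f y - f x) / (y - x) * (y - x)
    @[y --> within [set z : R | a <= z <= b] x^'] --> 0.
  by rewrite -(mulr0 l); exact: cvgM dl c0.
move/cvgrPdist_lt => c.
apply/cvgrPdist_lt => eps eps0; have := c _ eps0.
rewrite !near_withinE; apply: filterS => y h; rewrite /= in_itv /= => yab.
have [->|yx] := eqVneq y x; first by rewrite subrr normr0.
have := h yx yab; rewrite divfK ?subr_eq0 // sub0r normrN distrC; exact.
Qed.

(** * The price regimes at [beta = 0], the payoffs, and continuity in the parameters *)

Section Prices.
Context {R : realType} (phih : R) (f : R -> R) (Lambda e : R) (N : nat).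
Hypothesis phih_gt0 : 0 < phih.
Hypothesis f_decr : strictly_decreasing_on 0 phih f.
Hypothesis f_diff : differentiable_on 0 phih f.
Hypothesis f_range : forall phi : R, 0 <= phi <= phih -> 0 < f phi <= 1.
Hypothesis f0 : f 0 = 1.
Hypothesis Lambda_gt0 : 0 < Lambda.
Hypothesis e_gt0 : 0 < e.
Hypothesis N_gt0 : (0 < N)%N.

Lemma f_gt0 phi : 0 <= phi <= phih -> 0 < f phi.
Proof. by move=> /f_range /andP[]. Qed.

Lemma f_ltE phi psi : 0 <= phi <= phih -> 0 <= psi <= phih ->
  (phi < psi) = (f psi < f phi).
Proof.
move=> /andP[p0 ph] /andP[q0 qh]; case: ltgtP => [pq|qp|->].
- by rewrite f_decr.
- by apply/esym/negbTE; rewrite -leNgt ltW // f_decr.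
- by rewrite ltxx.
Qed.

(** Turns every price regime into a comparison of values of [f]. A preimage of [x] within the range
    of [f] comes from the intermediate value theorem. *)
Lemma below_finvE x phi : 0 <= phi <= phih ->
  below_finv phih f x phi = (x < f phi).
Proof.
move=> phiI.
rewrite /below_finv /Defs.finv; have [xh|hx] := ltP x (f phih); rewrite ?orbT ?orbF.
  apply/esym; apply: (lt_le_trans xh); move: phiI => /andP[phi0].
  rewrite le_eqVlt => /predU1P[->//|phih_lt]; exact/ltW/f_decr.
have [x1|x1] := leP x 1; last first.
  have /andP[phi0 _] := phiI.
  rewrite (ltNge phi 0) phi0 /=; apply/esym/negbTE; rewrite -leNgt ltW //.
  by have /andP[_ f1] := f_range phiI; exact: le_lt_trans x1.
have [|c cI fc] := IVT (ltW phih_gt0) (differentiable_on_continuous f_diff) (v := x).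
  by rewrite f0 ge_min le_max x1 hx orbT.
rewrite in_itv /= in cI.
case: xgetP => [psi _ /= [psiI fpsi]|/(_ c) []//].
by rewrite -fpsi; exact: f_ltE.
Qed.

Lemma D0_low phi alpha l : 0 < f phi -> l * f phi <= e ->
  D f e N phi 0 alpha l = 1 - f phi.
Proof.
move=> f1 le; rewrite /D eqxx /D_zero; case: ltP => [l0|] /=; last by rewrite addr0.
by rewrite ltNge ler_pdivlMr ?mulr_gt0 // mul1r le /= addr0.
Qed.

Lemma D0_high phi alpha l : 0 < f phi -> e < l * f phi ->
  D f e N phi 0 alpha l = 1 - f phi + (f phi - e / l) *
    (1 + alpha * \sum_(1 <= n < N.+1) n%:R^-1 * (e / (l * f phi)) ^+ n).
Proof.
move=> f1 le; have x0 := lt_trans e_gt0 le.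
have l0 : 0 < l by rewrite -(pmulr_lgt0 _ f1).
rewrite /D eqxx /D_zero l0 ltr_pdivrMr // mul1r le /=; congr (_ + _ * _).
by field; rewrite (gt_eqF l0) (gt_eqF f1).
Qed.

(** In each explicit branch the prescribed rate is a constrained zero of the gap; the remaining
    branches are [lambda_star]. *)
Lemma lambda_high_crossing phi1 phi2 alpha :
  0 <= phi1 <= phih -> 0 <= phi2 <= phih -> phi2 < phi1 -> 0 <= alpha < 1 ->
  crossing Lambda (gap f Lambda e N phi1 phi2 0 alpha)
    (lambda_high phih f Lambda e N phi1 phi2 alpha).
Proof.
move=> I1 I2 p21 a01; have f12 : f phi1 < f phi2 by rewrite -f_ltE.
have f1 := f_gt0 I1; have f2 := f_gt0 I2.
have star : crossing Lambda (gap f Lambda e N phi1 phi2 0 alpha)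
    (lambda_star f Lambda e N phi1 phi2 0 alpha).
  by apply: lambda_star_crossing => //; right.
have zero l0 := @constrained_zero_crossing R Lambda _ l0
  (gap_strict_below0 N e_gt0 f1 f2 (lexx 0) a01 (or_intror f12)).
have L00 : 0 <= (0 : R) <= Lambda by rewrite lexx ltW.
have D1 : D f e N phi1 0 alpha 0 = 1 - f phi1.
  by rewrite D0_low // mul0r ltW.
rewrite /lambda_high !below_finvE //; case: eqVneq => [a0|an0]; last first.
  rewrite /=; case: ifPn => // h1; case: ifPn => // h2; apply: (zero 0 L00).
  right; left; split=> //; rewrite /gap D1 subr0.
  (* In the first case the denominator of [alpha_bar] is not positive, but the gap at 0 is simply
     f(phi2) - f(phi1). *)
  have [le|ge] := leP (Lambda * f phi2) e; first by rewrite D0_low //; lra.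
  rewrite D0_high //.
  have S0 : 0 < \sum_(1 <= n < N.+1) n%:R^-1 * (e / (Lambda * f phi2)) ^+ n.
    rewrite big_nat_recl // ltr_pwDl //.
      by rewrite invr1 mul1r expr1 divr_gt0 // mulr_gt0.
    by apply: sumr_ge0 => i _; rewrite mulr_ge0 // exprn_ge0 // divr_ge0 ?mulr_ge0 // ltW.
  have r2 : e / Lambda < f phi2 by rewrite ltr_pdivrMr // mulrC.
  move: h2; rewrite -leNgt /alpha_bar; move: S0.
  set S := \sum_(1 <= n < N.+1) _ => S0.
  (* With the denominator cleared, alpha <= [alpha_bar] says that the gap at 0 is nonnegative. *)
  rewrite ler_pdivlMr; last by rewrite mulr_gt0 // subr_gt0.
  by rewrite mulrDr mulr1 mulrA [(_ - _) * alpha]mulrC -mulrA; lra.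
subst alpha.
have high phi l : 0 < f phi -> e < l * f phi -> D f e N phi 0 0 l = 1 - e / l.
  by move=> f_0 le; rewrite D0_high // mul0r addr0 mulr1; ring.
case: ifPn => [h1|]; last rewrite -leNgt => h1.
  have h1' : 2 * e < Lambda * f phi1 by rewrite mulrA ltr_pdivrMr // [f _ * _]mulrC in h1.
  have h2' : 2 * e < Lambda * f phi2.
    by apply: lt_trans h1' _; rewrite ltr_pM2l.
  apply: zero; first by have := Lambda_gt0; lra.
  left; rewrite /gap (_ : Lambda - Lambda / 2 = Lambda / 2); last lra.
  by rewrite !high ?subrr //; lra.
case: ifPn => [h2|]; last rewrite -leNgt => h2.
  (* Platform 2 receives e / f(phi1) > e / f(phi2), so its delay is 1 - f(phi1), which is that of
     platform 1 at zero idle probability. *)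
  have h1' : Lambda * f phi1 <= 2 * e by rewrite mulrA ler_pdivlMr // [f _ * _]mulrC in h1.
  have h2' : e < Lambda * f phi1 by rewrite ltr_pdivrMr // [f _ * _]mulrC in h2.
  apply: zero.
    rewrite subr_ge0 gerBl divr_ge0 ?(ltW e_gt0) ?(ltW f1) // andbT.
    by rewrite ler_pdivrMr // ltW.
  left; rewrite /gap D0_low // ?high //; last first.
  - by rewrite mulrBl divfK ?gt_eqF //; lra.
  - by rewrite subKr mulrAC ltr_pdivlMr // ltr_pM2l.
  - by rewrite subKr invf_div mulrCA divff ?gt_eqF // mulr1 subrr.
apply: (zero 0 L00); right; left; split=> //; rewrite /gap D1 subr0.
have [le|ge] := leP (Lambda * f phi2) e; first by rewrite D0_low //; lra.
by rewrite high //; lra.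
Qed.

Lemma lambda1_crossing phi1 phi2 beta alpha :
  0 <= phi1 <= phih -> 0 <= phi2 <= phih -> phi1 != phi2 ->
  0 <= beta -> 0 <= alpha < 1 ->
  crossing Lambda (gap f Lambda e N phi1 phi2 beta alpha)
    (lambda1 phih f Lambda e N phi1 phi2 beta alpha).
Proof.
move=> I1 I2 p12 b0 a01; rewrite /lambda1; case: eqVneq => [->|bn0].
  case: (ltgtP phi2 phi1) => [p21|p12'|E]; first exact: lambda_high_crossing.
    by apply: crossing_gap_swap; exact: lambda_high_crossing.
  by rewrite E eqxx in p12.
apply: lambda_star_crossing => //; try exact: f_gt0.
by left; rewrite lt_neqAle eq_sym bn0.
Qed.

(** For [0 < beta] the gap vanishes at [Lambda / 2] by symmetry. At [beta = 0] it can vanish on a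
    whole interval, and the definition fixes the value. *)
Lemma lambda1_tie phi beta alpha : 0 <= phi <= phih ->
  0 <= beta -> 0 <= alpha < 1 ->
  lambda1 phih f Lambda e N phi phi beta alpha = Lambda / 2.
Proof.
move=> I b0 a01; rewrite /lambda1 !ltxx; case: eqVneq => // bn0.
have b1 : 0 < beta by rewrite lt_neqAle eq_sym bn0.
have f1 := f_gt0 I.
apply: (crossing_unique (h := gap f Lambda e N phi phi beta alpha)).
  by apply: lambda_star_crossing => //; left.
apply: constrained_zero_crossing.
- by apply: gap_strict_below0 => //; left.
- by have := Lambda_gt0; lra.
- by left; rewrite /gap (_ : Lambda - Lambda / 2 = Lambda / 2) ?subrr //; lra.
Qed.

Lemma lambda1_itv phi1 phi2 beta alpha :
  0 <= phi1 <= phih -> 0 <= phi2 <= phih -> 0 <= beta -> 0 <= alpha < 1 ->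
  0 <= lambda1 phih f Lambda e N phi1 phi2 beta alpha <= Lambda.
Proof.
move=> I1 I2 b0 a01; have [<-|p12] := eqVneq phi1 phi2.
  by rewrite lambda1_tie //; have := Lambda_gt0; lra.
by have [] := lambda1_crossing I1 I2 p12 b0 a01.
Qed.

(** For distinct prices both sides cross the gap of the interchanged platforms, so uniqueness
    applies; this reduces platform 2 to platform 1. *)
Lemma lambda2_lambda1 phi1 phi2 beta alpha :
  0 <= phi1 <= phih -> 0 <= phi2 <= phih -> 0 <= beta -> 0 <= alpha < 1 ->
  lambda2 phih f Lambda e N phi1 phi2 beta alpha =
  lambda1 phih f Lambda e N phi2 phi1 beta alpha.
Proof.
move=> I1 I2 b0 a01; rewrite /lambda2; have [<-|p12] := eqVneq phi1 phi2.
  by rewrite lambda1_tie //; lra.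
apply: (crossing_unique (h := gap f Lambda e N phi2 phi1 beta alpha)).
  exact/crossing_gap_swap/lambda1_crossing.
by apply: lambda1_crossing => //; rewrite eq_sym.
Qed.

(** The value is min(e, x), the common shape of the payoffs at [beta = 0]. *)
Lemma served_idle0 (x : R) : x * (1 - idle0 e x) = if e < x then e else x.
Proof.
case: ltP => xe; last by rewrite idle0_le // subr0 mulr1.
rewrite idle0_ge // ?(ltW xe) // subKr mulrCA divff ?mulr1 //.
by rewrite gt_eqF // (lt_trans e_gt0).
Qed.

(** One formula for all regimes, so that the payoff inherits continuity from the split and from
    [idle]. *)
Lemma M1_idle phi1 phi2 beta alpha :
  0 <= phi1 <= phih -> 0 <= phi2 <= phih -> 0 <= beta -> 0 <= alpha < 1 ->
  let x := lambda1 phih f Lambda e N phi1 phi2 beta alpha * f phi1 in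
  M1 phih f Lambda e N phi1 phi2 beta alpha = x * phi1 * (1 - idle e x beta).
Proof.
move=> I1 I2 b0 a01; rewrite /M1 /payoff; case: eqVneq => [->|bn0] /=; last first.
  by rewrite /idle (negbTE bn0).
have f1 := f_gt0 I1; have f2 := f_gt0 I2.
rewrite idle_b0 [_ * phi1 * (1 - _)]mulrAC served_idle0.
case: eqVneq => [a0|an0]; last first.
  by rewrite [f phi1 * _]mulrC; case: ifP => _ //; rewrite mulrAC.
rewrite /lambda1 eqxx /lambda_high a0 eqxx; case: (ltgtP phi2 phi1) => [p21|p12|E].
- rewrite /M00_high !below_finvE //; case: ifPn => [h1|]; last rewrite -leNgt => h1.
    have h2 : 2 * e < Lambda * f phi1 by rewrite mulrA ltr_pdivrMr // [f _ * _]mulrC in h1.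
    by rewrite (_ : e < _) //; lra.
  case: ifPn => [h2|_]; last by rewrite mul0r ltNge (ltW e_gt0) /= mul0r.
  have h3 : Lambda * f phi1 <= 2 * e by rewrite mulrA ler_pdivlMr // [f _ * _]mulrC in h1.
  have -> : (Lambda - e / f phi1) * f phi1 = Lambda * f phi1 - e.
    by rewrite mulrBl divfK ?gt_eqF.
  by rewrite ltNge (_ : _ <= e) //; lra.
- have f21 : f phi2 < f phi1 by rewrite -f_ltE.
  rewrite /M00_low !below_finvE //; case: ifPn => [h1|_].
    have : 2 * e < Lambda * f phi2 by rewrite mulrA ltr_pdivrMr // [f _ * _]mulrC in h1.
    have : Lambda * f phi2 < Lambda * f phi1 by rewrite ltr_pM2l.
    move=> h2 h3; rewrite (_ : e < _) //; lra.
  case: ifPn => [h2|_].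
    (* The cheaper platform has x = e f(phi1) / f(phi2) > e. *)
    by rewrite subKr mulrAC ltr_pdivlMr // ltr_pM2l // f21.
  by rewrite subr0; case: ifP.
- rewrite /M00_tie below_finvE //.
  rewrite (_ : (_ < f phi1) = (e < Lambda / 2 * f phi1)); first by case: ifP.
  by rewrite mulrA ltr_pdivrMr // [f _ * _]mulrC; apply/idP/idP => h; lra.
Qed.

Local Notation params p0 := (within (parameter_domain R) (nbhs p0)).

Lemma params_fst (p0 : R * R) : p.1 @[p --> params p0] --> p0.1.
Proof. by apply: cvg_within_filter; case: p0 => b alpha; exact: cvg_fst. Qed.

Lemma params_snd (p0 : R * R) : p.2 @[p --> params p0] --> p0.2.
Proof. by apply: cvg_within_filter; case: p0 => b alpha; exact: cvg_snd. Qed.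

(** Equal prices give a constant split. Otherwise [crossing_cvg] applies, and points with [beta = 0]
    are treated like all others. *)
Lemma lambda1_cvg phi1 phi2 p0 :
  0 <= phi1 <= phih -> 0 <= phi2 <= phih -> parameter_domain R p0 ->
  lambda1 phih f Lambda e N phi1 phi2 p.1 p.2 @[p --> params p0] -->
  lambda1 phih f Lambda e N phi1 phi2 p0.1 p0.2.
Proof.
move=> I1 I2 [b0 a0].
have dom : \forall p \near params p0, parameter_domain R p by exact: withinT.
have [<-|p12] := eqVneq phi1 phi2.
  rewrite lambda1_tie //.
  have E : \forall p \near params p0, Lambda / 2 =
      lambda1 phih f Lambda e N phi1 phi1 p.1 p.2.
    by apply: filterS dom => p [pb pa]; rewrite lambda1_tie.
  by apply: cvg_trans (near_eq_cvg E) _; exact: cvg_cst.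
apply: (crossing_cvg (h := fun p => gap f Lambda e N phi1 phi2 p.1 p.2)
  (h0 := gap f Lambda e N phi1 phi2 p0.1 p0.2) (Lambda := Lambda)).
- by apply: filterS dom => p [pb pa]; exact: lambda1_crossing.
- exact: lambda1_crossing.
- move=> l lI; apply: (gap_cvg e_gt0 (u := fst) (v := fun=> l) (w := snd)) => //; try exact: f_gt0.
  + by apply: filterS dom => p [pb pa].
  + exact: params_fst.
  + exact: cvg_cst.
  + exact: params_snd.
Qed.

Lemma M1_cvg phi1 phi2 p0 :
  0 <= phi1 <= phih -> 0 <= phi2 <= phih -> parameter_domain R p0 ->
  M1 phih f Lambda e N phi1 phi2 p.1 p.2 @[p --> params p0] -->
  M1 phih f Lambda e N phi1 phi2 p0.1 p0.2.
Proof.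
move=> I1 I2 p0d; have [b0 a0] := p0d.
have dom : \forall p \near params p0, parameter_domain R p by exact: withinT.
rewrite M1_idle //=.
have E : \forall p \near params p0,
    let x := lambda1 phih f Lambda e N phi1 phi2 p.1 p.2 * f phi1 in
    x * phi1 * (1 - idle e x p.1) = M1 phih f Lambda e N phi1 phi2 p.1 p.2.
  by apply: filterS dom => p [pb pa] /=; rewrite M1_idle.
apply: cvg_trans (near_eq_cvg E) _ => /=.
have f1 := ltW (f_gt0 I1).
have cx : lambda1 phih f Lambda e N phi1 phi2 p.1 p.2 * f phi1
    @[p --> params p0] --> lambda1 phih f Lambda e N phi1 phi2 p0.1 p0.2 * f phi1.
  by apply: cvgMl; exact: lambda1_cvg.
apply: cvgM; first exact: cvgMl.
apply: cvgB; first exact: cvg_cst.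
apply: idle_cvg => //.
- by have /andP[l0 _] := lambda1_itv I1 I2 b0 a0; rewrite mulr_ge0.
- apply: filterS dom => p [pb pa]; split=> //.
  by have /andP[l0 _] := lambda1_itv I1 I2 pb pa; rewrite mulr_ge0.
- exact: params_fst.
Qed.

Lemma lambda2_cvg phi1 phi2 p0 :
  0 <= phi1 <= phih -> 0 <= phi2 <= phih -> parameter_domain R p0 ->
  lambda2 phih f Lambda e N phi1 phi2 p.1 p.2 @[p --> params p0] -->
  lambda2 phih f Lambda e N phi1 phi2 p0.1 p0.2.
Proof.
move=> I1 I2 p0d.
by apply: cvgB; [exact: cvg_cst|exact: lambda1_cvg].
Qed.

Lemma M2_cvg phi1 phi2 p0 :
  0 <= phi1 <= phih -> 0 <= phi2 <= phih -> parameter_domain R p0 ->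
  M2 phih f Lambda e N phi1 phi2 p.1 p.2 @[p --> params p0] -->
  M2 phih f Lambda e N phi1 phi2 p0.1 p0.2.
Proof.
move=> I1 I2 p0d; have [b0 a0] := p0d.
have M2E p : parameter_domain R p ->
    M1 phih f Lambda e N phi2 phi1 p.1 p.2 = M2 phih f Lambda e N phi1 phi2 p.1 p.2.
  by move=> [pb pa]; rewrite /M2 lambda2_lambda1.
rewrite -M2E //; apply: cvg_trans (M1_cvg I2 I1 p0d).
by apply: near_eq_cvg; apply: filterS (withinT _ _) => p /M2E.
Qed.
End Prices.

Theorem theorem6 (R : realType) (phih : R) (f : R -> R) (Lambda e : R)
    (Nbar : nat) (phi1 phi2 : R)
    (phih_gt0 : 0 < phih)
    (f_concave : strictly_concave_on 0 phih f)
    (f_decr : strictly_decreasing_on 0 phih f)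
    (f_diff : differentiable_on 0 phih f)
    (f_range : forall phi : R, 0 <= phi <= phih -> 0 < f phi <= 1)
    (f0 : f 0 = 1)
    (Lambda_gt0 : 0 < Lambda) (e_gt0 : 0 < e) (Nbar_gt0 : (0 < Nbar)%N)
    (phi1_range : 0 <= phi1 <= phih) (phi2_range : 0 <= phi2 <= phih) :
  [/\ {within parameter_domain R, continuous
        (fun p : R * R => lambda1 phih f Lambda e Nbar phi1 phi2 p.1 p.2)},
      {within parameter_domain R, continuous
        (fun p : R * R => lambda2 phih f Lambda e Nbar phi1 phi2 p.1 p.2)},
      {within parameter_domain R, continuous
        (fun p : R * R => M1 phih f Lambda e Nbar phi1 phi2 p.1 p.2)} &
      {within parameter_domain R, continuous
        (fun p : R * R => M2 phih f Lambda e Nbar phi1 phi2 p.1 p.2)}].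
Proof.
split; apply/subspace_continuousP => p0 p0d.
- exact: lambda1_cvg.
- exact: lambda2_cvg.
- exact: M1_cvg.
- exact: M2_cvg.
Qed.
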